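(* Suppose that $\theta,\kappa$ are infinite regular cardinals with $\kappa>2^\theta$. If $\kappa$ carries a uniform ultrafilter that is $\mu$-indecomposable for every cardinal $\mu\in[\theta,\kappa)$, then there exists a cardinal $\mu<\theta$ such that $\chi(\vec C)\le\mu$ for every transversal $\vec C$ for $\square(\kappa,{<}\kappa)$.
   Context: For a set of ordinals $A$, $\mathrm{acc}(A)=\{\alpha\in A\mid\sup(A\cap\alpha)=\alpha>0\}$. A $\square(\kappa,{<}\kappa)$-sequence is a sequence $\langle\mathcal C_\alpha\mid\alpha<\kappa\rangle$ such that each $\mathcal C_\alpha$ is a nonempty family of fewer than $\kappa$ closed subsets $C$ of $\alpha$ with $\sup(C)=\sup(\alpha)$; for every $C\in\mathcal C_\alpha$ and $\bar\alpha\in\mathrm{acc}(C)$, $C\cap\bar\alpha\in\mathcal C_{\bar\alpha}$; and there is no club $D\subseteq\kappa$ with $D\cap\alpha\in\mathcal C_\alpha$ for all $\alpha\in\mathrm{acc}(D)$. A transversal for $\square(\kappa,{<}\kappa)$ is a sequence $\langle C_\alpha\mid\alpha<\kappa\rangle$ with $C_\alpha\in\mathcal C_\alpha$ for all $\alpha$, for some $\square(\kappa,{<}\kappa)$-sequence $\langle\mathcal C_\alpha\mid\alpha<\kappa\rangle$. For a sequence $\vec C=\langle C_\beta\mid\beta<\kappa\rangle$, $\chi(\vec C)$ is the least cardinal $\chi\le\kappa$ such that there exist $\Delta\in[\kappa]^\kappa$ and $b:\kappa\to[\kappa]^\chi$ with $\Delta\cap\alpha\subseteq\bigcup_{\beta\in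 b(\alpha)}C_\beta$ for every $\alpha<\kappa$. An ultrafilter $U$ over $\kappa$ is uniform if all its members have size $\kappa$; it is $\mu$-indecomposable if for every $f:\kappa\to\mu$ there is $H\subseteq\mu$ with $|H|<\mu$ and $f^{-1}[H]\in U$. *)

(* Defs.v *)
(* Ordinals below a cardinal are modelled as the elements of a
   well-ordered type; cardinals are modelled by types (compared via injections
   / bijections).  Sets are predicates [T -> Prop]. *)
From Stdlib Require Import Relations Wellfounded.

Set Implicit Arguments.

Definition injective {A B : Type} (f : A -> B) : Prop :=
  forall x y, f x = f y -> x = y.
Definition bijective {A B : Type} (f : A -> B) : Prop :=
  injective f /\ forall y, exists x, f x = y.

Definition le_card (A B : Type) : Prop := exists f : A -> B, injective f.
Definition eq_card (A B : Type) : Prop := exists f : A -> B, bijective f.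
Definition lt_card (A B : Type) : Prop := le_card A B /\ ~ le_card B A.

Definition elts {T : Type} (A : T -> Prop) : Type := {x : T | A x}.

Definition is_wellorder {K : Type} (lt : K -> K -> Prop) : Prop :=
  (forall x, ~ lt x x) /\
  (forall x y z, lt x y -> lt y z -> lt x z) /\
  (forall x y, lt x y \/ x = y \/ lt y x) /\
  well_founded lt.

Section Ord.
Context {K : Type} (lt : K -> K -> Prop).

Definition leo (x y : K) : Prop := lt x y \/ x = y.

(* The well-ordered type (K, lt) has order type an infinite regular cardinal:
   it is infinite, every proper initial segment has smaller cardinality
   (so its order type is a cardinal), and every unbounded (cofinal) subset
   has full cardinality (cofinality = the cardinal). *)
Definition infinite_regular_cardinal : Prop :=
  is_wellorder lt /\
  le_card nat K /\
  (forall a : K, lt_card (elts (fun b => lt b a)) K) /\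
  (forall A : K -> Prop, (forall a, exists b, A b /\ leo a b) ->
     eq_card (elts A) K).

Definition limpt (A : K -> Prop) (g : K) : Prop :=
  (exists d, lt d g) /\
  (forall d, lt d g -> exists e, A e /\ lt d e /\ lt e g).

Definition acc (A : K -> Prop) (g : K) : Prop := A g /\ limpt A g.

Definition closed_in (a : K) (C : K -> Prop) : Prop :=
  (forall x, C x -> lt x a) /\ (forall g, lt g a -> limpt C g -> C g).

(* upper bounds; two sets of ordinals below kappa have the same sup iff they
   have the same upper bounds *)
Definition ub (A : K -> Prop) (d : K) : Prop := forall e, A e -> leo e d.
Definition same_sup (A B : K -> Prop) : Prop := forall d, ub A d <-> ub B d.

Definition below (a : K) : K -> Prop := fun x => lt x a.
Definition cap (A B : K -> Prop) : K -> Prop := fun x => A x /\ B x.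

Definition club (D : K -> Prop) : Prop :=
  (forall g, limpt D g -> D g) /\ (forall a, exists b, D b /\ lt a b).

Definition square_seq (F : K -> (K -> Prop) -> Prop) : Prop :=
  (forall a, exists C, F a C) /\
  (forall a, lt_card (elts (F a)) K) /\
  (forall a C, F a C -> closed_in a C /\ same_sup C (below a)) /\
  (forall a C b, F a C -> acc C b -> F b (cap C (below b))) /\
  ~ (exists D, club D /\ forall a, acc D a -> F a (cap D (below a))).

Definition transversal (Cs : K -> K -> Prop) : Prop :=
  exists F, square_seq F /\ forall a, F a (Cs a).

(* chi(Cs) <= X is witnessed with the cardinal X:
   Delta in [kappa]^kappa, b : kappa -> [kappa]^X covering. *)
Definition chi_witness (Cs : K -> K -> Prop) (X : Type) : Prop :=
  exists Delta : K -> Prop, eq_card (elts Delta) K /\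
  exists b : K -> K -> Prop,
    (forall a, eq_card (elts (b a)) X) /\
    (forall a x, Delta x -> lt x a -> exists be, b a be /\ Cs be x).

Definition uniform_ultrafilter (U : (K -> Prop) -> Prop) : Prop :=
  U (fun _ => True) /\ ~ U (fun _ => False) /\
  (forall A B, U A -> (forall x, A x -> B x) -> U B) /\
  (forall A B, U A -> U B -> U (cap A B)) /\
  (forall A, U A \/ U (fun x => ~ A x)) /\
  (forall A, U A -> eq_card (elts A) K).

End Ord.

Definition indecomposable {K : Type} (U : (K -> Prop) -> Prop) (M : Type) : Prop :=
  forall f : K -> M, exists H : M -> Prop,
    lt_card (elts H) M /\ U (fun x => H (f x)).

(* Main.v *)
(** An ultrafilter [U] that is indecomposable on [theta] has a substitute for
    completeness: if [B_i] is in [U] for each [i < theta], then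
    [U]-almost every point lies in [B_i] for unboundedly many [i].  This
    rules out [theta] many coherent descents among functions unbounded modulo
    [U], so there is a least function [g : kappa -> kappa] unbounded modulo [U].
    Every function below [g] being bounded, [theta] successive bounds for
    [min (C_(g x) \ xi)] converge to a [d] that is a limit point of [C_(g x)] for
    [U]-almost all [x]; let [Delta] be the unbounded set of all [d] such that [d]
    is in [C_(g x)] for [U]-almost all [x].

    By coherence there are fewer than [kappa] traces [C_(g x) /\ alpha], hence by
    indecomposability fewer than [theta] of them on a set in [U], and choosing
    one [x] per trace covers [Delta /\ alpha].  If no bound below [theta] were
    uniform, choose for each [i < theta] a transversal [C^i] and an [alpha_i]
    whose traces are more than [i] on each set in [U]; the joint map
    [x |-> (C^i_(g x) /\ alpha_i)_i] has at most [2^theta < kappa] values modulo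
    coding, so fewer than [theta] values on a set in [U], a contradiction. *)
Require Import Defs.
From Stdlib Require Import Classical ClassicalEpsilon FunctionalExtensionality
  PropExtensionality.

(** * Comparing cardinals by injections *)

Lemma elts_eq {T : Type} (A : T -> Prop) (x y : elts A) :
  proj1_sig x = proj1_sig y -> x = y.
Proof.
  destruct x as [x p], y as [y q]; simpl; intros ->.
  f_equal; apply proof_irrelevance.
Qed.

(** Lets an injection be extracted from a relation that need not be single-valued; the choice of
    values is made once, here. *)
Lemma le_card_rel {A B : Type} (R : A -> B -> Prop) :
  (forall a, exists b, R a b) -> (forall a a' b, R a b -> R a' b -> a = a') ->
  le_card A B.
Proof.
  intros Htot Hinj.
  exists (fun a => proj1_sig (constructive_indefinite_description _ (Htot a))).
  intros a a' E.
  destruct (constructive_indefinite_description _ (Htot a)) as [b Hb].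
  destruct (constructive_indefinite_description _ (Htot a')) as [b' Hb'].
  simpl in E; subst b'; eauto.
Qed.

Lemma le_card_refl (A : Type) : le_card A A.
Proof. exists (fun x => x); intros x y E; exact E. Qed.

Lemma le_card_trans {A B C : Type} : le_card A B -> le_card B C -> le_card A C.
Proof.
  intros [f Hf] [g Hg]; exists (fun x => g (f x)); intros x y E; auto.
Qed.

Lemma le_card_sub {T : Type} (A B : T -> Prop) :
  (forall x, A x -> B x) -> le_card (elts A) (elts B).
Proof.
  intros H. apply (le_card_rel (fun a b => proj1_sig a = proj1_sig b)).
  - intros [a p]; exists (exist _ a (H a p)); reflexivity.
  - intros a a' b E E'; exact (elts_eq _ _ _ (eq_trans E (eq_sym E'))).
Qed.

Lemma le_card_elts {T : Type} (A : T -> Prop) : le_card (elts A) T.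
Proof. exists (@proj1_sig _ _); intros x y; apply elts_eq. Qed.

Lemma le_card_image {S T : Type} (A : S -> Prop) (f : S -> T) :
  le_card (elts (fun y => exists x, A x /\ f x = y)) (elts A).
Proof.
  apply (le_card_rel (fun y x => f (proj1_sig x) = proj1_sig y)).
  - intros [y (x & p & E)]; exists (exist _ x p); exact E.
  - intros y y' x E E'; exact (elts_eq _ _ _ (eq_trans (eq_sym E) E')).
Qed.

Lemma eq_card_le {A B : Type} : eq_card A B -> le_card B A.
Proof.
  intros (f & Hinj & Hsur).
  apply (le_card_rel (fun b a => f a = b)); [exact Hsur | congruence].
Qed.

(** * Well-founded recursion and comparability of cardinals *)

Lemma wf_min {A : Type} (R : A -> A -> Prop) (P : A -> Prop) :
  well_founded R -> (exists x, P x) ->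
  exists x, P x /\ forall y, R y x -> ~ P y.
Proof.
  intros wf [x Hx]. revert Hx. induction (wf x) as [x _ IH]; intros Hx.
  destruct (classic (exists y, R y x /\ P y)) as [(y & Hy & Py) | Hn].
  - exact (IH y Hy Py).
  - exists x; split; [exact Hx|]. intros y Hy Py; apply Hn; eauto.
Qed.

(** Recursion by specification: [P a f v] takes a total [f], but the third hypothesis makes only the
    values before [a] matter, so solving each single stage is enough. *)
Lemma wf_choice {A V : Type} (R : A -> A -> Prop)
    (P : A -> (A -> V) -> V -> Prop) :
  well_founded R -> inhabited V ->
  (forall a f f' v, (forall b, R b a -> f b = f' b) -> P a f v -> P a f' v) ->
  (forall a f, (forall b, R b a -> P b f (f b)) -> exists v, P a f v) ->
  exists f, forall a, P a f (f a).
Proof.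
  intros wf inhV Ploc Pex.
  (* [ext] makes the values built so far total; its default value is invisible to [P]. *)
  pose (ext := fun a (rec : forall b, R b a -> V) b =>
    match excluded_middle_informative (R b a) with
    | left h => rec b h
    | right _ => epsilon inhV (fun _ => True)
    end).
  pose (F := fun a rec => epsilon inhV (P a (ext a rec))).
  pose (f := Fix wf (fun _ => V) F).
  assert (Hf : forall a, f a = epsilon inhV (P a (ext a (fun b _ => f b)))).
  { intros a. unfold f at 1. rewrite Fix_eq; [reflexivity|].
    intros x g g' E. f_equal.
    extensionality y; extensionality p; apply E. }
  exists f. intros a. induction (wf a) as [a _ IH].
  assert (E : forall b, R b a -> f b = ext a (fun b _ => f b) b).
  { intros b Hb. unfold ext.
    destruct (excluded_middle_informative (R b a)); tauto. }
  apply Ploc with (f := ext a (fun b _ => f b)).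
  - intros b Hb; symmetry; auto.
  - rewrite Hf. apply epsilon_spec.
    destruct (Pex a f IH) as [v Hv]. exists v. exact (Ploc _ _ _ _ E Hv).
Qed.

(* Map [A] into [B] greedily, always picking an unused value; the first [c] at
   which no value is left gives [B] the size of the segment below [c]. *)
Lemma wo_compare {A B : Type} (R : A -> A -> Prop) :
  is_wellorder R -> inhabited B ->
  le_card A B \/
  exists c, le_card B (elts (fun x => R x c)) /\ le_card (elts (fun x => R x c)) B.
Proof.
  intros (_ & Rtr & Rtot & wf) inhB.
  destruct (wf_choice R
    (fun a (f : A -> B) v => (exists b, forall a', R a' a -> f a' <> b) ->
       forall a', R a' a -> f a' <> v) wf inhB) as [g Hg].
  - intros a f f' v E H [b Hb] a' Ha'. rewrite <- E by assumption.
    apply H; [|assumption]. exists b. intros a'' Ha''. rewrite E by assumption.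
    auto.
  - intros a f _.
    destruct (classic (exists b, forall a', R a' a -> f a' <> b)) as [[b Hb] | Hn].
    + exists b; auto.
    + destruct inhB as [b]; exists b; tauto.
  - assert (Hinj : forall x y,
      (exists b, forall a', R a' y -> g a' <> b) -> R x y -> g x <> g y).
    { intros x y Hy Hxy. exact (Hg y Hy x Hxy). }
    destruct (classic (forall c, exists b, forall a', R a' c -> g a' <> b))
      as [Hall | Hn].
    + left. exists g. intros x y E.
      destruct (Rtot x y) as [H | [H | H]]; [|exact H|];
        destruct (Hinj _ _ (Hall _) H); congruence.
    + right. apply not_all_ex_not in Hn.
      destruct (wf_min R _ wf Hn) as (c & Hc & Hmin). exists c. split.
      * apply (le_card_rel (fun b x => g (proj1_sig x) = b)); [|congruence].
        intros b. apply NNPP. intros Hb. apply Hc. exists b.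
        intros a' Ha' E. apply Hb. exists (exist _ a' Ha'); exact E.
      * exists (fun x => g (proj1_sig x)). intros [x px] [y py] E.
        apply elts_eq; simpl in *.
        destruct (Rtot x y) as [H | [H | H]]; [|exact H|].
        -- destruct (Hinj _ _ (NNPP _ (Hmin y py)) H); congruence.
        -- destruct (Hinj _ _ (NNPP _ (Hmin x px)) H); congruence.
Qed.

(** The sets [b a] in [chi_witness] must have exactly the prescribed size, so small ones are padded:
    elements of [M] in the range of [e] go back to [A], the others go into its complement by [j]. *)
Lemma pad_card {T M : Type} (A : T -> Prop) :
  le_card (elts A) M -> le_card M (elts (fun x => ~ A x)) ->
  exists B : T -> Prop, (forall x, A x -> B x) /\ eq_card (elts B) M.
Proof.
  intros [e He] [j Hj].
  pose (R := fun (m : M) (x : T) =>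
    (exists a, e a = m /\ proj1_sig a = x) \/
    (~ (exists a, e a = m) /\ proj1_sig (j m) = x)).
  assert (Rfun : forall m x y, R m x -> R m y -> x = y).
  { intros m x y [(a & E & <-) | [N <-]] [(a' & E' & <-) | [N' <-]];
      [|exfalso; eauto|exfalso; eauto|reflexivity].
    f_equal; apply He; congruence. }
  assert (Rinj : forall m m' x, R m x -> R m' x -> m = m').
  { intros m m' x [(a & E & Ex) | [N Ex]] [(a' & E' & Ex') | [N' Ex']].
    - rewrite <- E, <- E'. f_equal. apply elts_eq; congruence.
    - destruct (proj2_sig (j m')). rewrite Ex', <- Ex. apply proj2_sig.
    - destruct (proj2_sig (j m)). rewrite Ex, <- Ex'. apply proj2_sig.
    - apply Hj, elts_eq; congruence. }
  assert (Rtot : forall m, exists x, R m x).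
  { intros m. destruct (classic (exists a, e a = m)) as [[a E] | N].
    - exists (proj1_sig a); left; eauto.
    - exists (proj1_sig (j m)); right; auto. }
  exists (fun x => exists m, R m x). split.
  - intros x Hx. exists (e (exist _ x Hx)). left. exists (exist _ x Hx). auto.
  - exists (fun x : elts (fun x => exists m, R m x) =>
      proj1_sig (constructive_indefinite_description
        (fun m => R m (proj1_sig x)) (proj2_sig x))).
    split.
    + intros x y E.
      destruct (constructive_indefinite_description _ (proj2_sig x)) as [m Hm].
      destruct (constructive_indefinite_description _ (proj2_sig y)) as [m' Hm'].
      simpl in E; subst m'. apply elts_eq; eauto.
    + intros m. destruct (Rtot m) as [x Hx].
      exists (exist _ x (ex_intro _ m Hx)).
      destruct (constructive_indefinite_description _ _) as [m' Hm'].
      simpl in *; eauto.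
Qed.

(** * Arithmetic of an infinite regular cardinal *)

Section Regular.

Context {K : Type} (lt : K -> K -> Prop) (Hreg : infinite_regular_cardinal lt).

Lemma wo_irrefl x : ~ lt x x.
Proof. destruct Hreg as [(H & _) _]; auto. Qed.

Lemma wo_trans {x y z} : lt x y -> lt y z -> lt x z.
Proof. destruct Hreg as [(_ & H & _) _]; eauto. Qed.

Lemma wo_total x y : lt x y \/ x = y \/ lt y x.
Proof. destruct Hreg as [(_ & _ & H & _) _]; auto. Qed.

Lemma wo_wf : well_founded lt.
Proof. destruct Hreg as [(_ & _ & _ & H) _]; auto. Qed.

Lemma leo_refl x : leo lt x x.
Proof. right; reflexivity. Qed.

Lemma leo_lt_trans {x y z} : leo lt x y -> lt y z -> lt x z.
Proof. intros [H | ->]; [apply wo_trans, H | auto]. Qed.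

Lemma lt_leo_trans {x y z} : lt x y -> leo lt y z -> lt x z.
Proof. intros H [H' | <-]; [exact (wo_trans H H') | exact H]. Qed.

Lemma leo_trans {x y z} : leo lt x y -> leo lt y z -> leo lt x z.
Proof. intros H [H' | <-]; [left; exact (leo_lt_trans H H') | exact H]. Qed.

Lemma not_leo {x y} : ~ leo lt x y -> lt y x.
Proof. unfold leo; destruct (wo_total x y) as [H | [H | H]]; tauto. Qed.

Lemma not_lt {x y} : ~ lt x y -> leo lt y x.
Proof. unfold leo; destruct (wo_total x y) as [H | [H | H]]; auto; tauto. Qed.

Lemma leo_not_lt {x y} : leo lt x y -> ~ lt y x.
Proof. intros H H'; exact (wo_irrefl _ (leo_lt_trans H H')). Qed.

Lemma card_inhabited : inhabited K.
Proof. destruct Hreg as (_ & [f _] & _); exact (inhabits (f 0)). Qed.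

Lemma not_le_card_lt (X : Type) : ~ le_card K X -> lt_card X K.
Proof.
  intros H; split; [|exact H].
  destruct (classic (inhabited X)) as [HX | HX].
  - destruct Hreg as [Hwo _].
    destruct (wo_compare lt Hwo HX) as [H' | (c & H' & _)]; [tauto|].
    exact (le_card_trans H' (le_card_elts _)).
  - apply (le_card_rel (fun _ _ => True)); intros a; destruct HX; exact (inhabits a).
Qed.

Lemma not_le_card_seg a : ~ le_card K (elts (fun x => lt x a)).
Proof. destruct Hreg as (_ & _ & H & _); apply H. Qed.

Lemma not_le_card_bool : ~ le_card K bool.
Proof.
  destruct Hreg as (_ & Hnat & _). intros H.
  destruct (le_card_trans Hnat H) as [f Hf].
  pose proof (Hf 0 1). pose proof (Hf 0 2). pose proof (Hf 1 2).
  destruct (f 0), (f 1), (f 2); intuition discriminate.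
Qed.

Lemma small_bounded (A : K -> Prop) :
  ~ le_card K (elts A) -> exists a, forall x, A x -> lt x a.
Proof.
  intros H. destruct Hreg as (_ & _ & _ & Hcof). apply NNPP. intros Hn.
  apply H, eq_card_le, Hcof. intros a. apply NNPP. intros Ha. apply Hn.
  exists a. intros x Hx. apply not_leo. intros Hax. apply Ha; eauto.
Qed.

Lemma small_family_bounded {I : Type} (h : I -> K) :
  ~ le_card K I -> exists a, forall i, lt (h i) a.
Proof.
  intros HI.
  destruct (small_bounded (fun x => exists i, True /\ h i = x)) as [a Ha].
  - intros H. apply HI.
    refine (le_card_trans (le_card_trans H (le_card_image (fun _ => True) h)) _).
    apply le_card_elts.
  - exists a; intros i; apply Ha; eauto.
Qed.

Lemma no_max a : exists b, lt a b.
Proof.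
  destruct (small_family_bounded (fun _ : bool => a) not_le_card_bool) as [b Hb].
  exists b; exact (Hb true).
Qed.

Lemma unbounded_le_card (A : K -> Prop) :
  (forall a, exists b, A b /\ leo lt a b) -> le_card K (elts A).
Proof. intros H; apply eq_card_le, Hreg, H. Qed.

(** If all fibres were small, their bounds [b i] would have a common bound [a]; but [a] lies in the
    fibre of [h a], so it is below [b (h a)], hence below itself. *)
Lemma pigeonhole {I : Type} (h : K -> I) :
  ~ le_card K I -> exists i, le_card K (elts (fun x => h x = i)).
Proof.
  intros HI. apply NNPP. intros Hn.
  assert (Hb : forall i, exists a, forall x, h x = i -> lt x a).
  { intros i. apply small_bounded. eauto. }
  pose (b := fun i => proj1_sig (constructive_indefinite_description _ (Hb i))).
  destruct (small_family_bounded b HI) as [a Ha].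
  apply (wo_irrefl a). refine (wo_trans _ (Ha (h a))).
  exact (proj2_sig (constructive_indefinite_description _ (Hb (h a))) a eq_refl).
Qed.

Lemma small_union {I V : Type} (A : I -> V -> Prop) :
  ~ le_card K I -> (forall i, ~ le_card K (elts (A i))) ->
  ~ le_card K (elts (fun v => exists i, A i v)).
Proof.
  intros HI HA [g Hg].
  pose (h := fun x =>
    proj1_sig (constructive_indefinite_description _ (proj2_sig (g x)))).
  assert (Hh : forall x, A (h x) (proj1_sig (g x))).
  { intros x. apply (proj2_sig (constructive_indefinite_description _ (proj2_sig (g x)))). }
  destruct (pigeonhole h HI) as [i Hi]. apply (HA i), (le_card_trans Hi).
  apply (le_card_rel (fun x v => proj1_sig (g (proj1_sig x)) = proj1_sig v)).
  - intros [x E]; simpl. pose proof (Hh x) as H. rewrite E in H.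
    exists (exist _ _ H); reflexivity.
  - intros x y v E E'. apply elts_eq, Hg, elts_eq; congruence.
Qed.

Lemma small_cup {V : Type} (A B : V -> Prop) :
  ~ le_card K (elts A) -> ~ le_card K (elts B) ->
  ~ le_card K (elts (fun v => A v \/ B v)).
Proof.
  intros HA HB H.
  apply (small_union (fun (i : bool) => if i then A else B) not_le_card_bool).
  - intros [|]; assumption.
  - apply (le_card_trans H), le_card_sub. intros v [Hv | Hv];
      [exists true | exists false]; exact Hv.
Qed.

Lemma small_seg {X : Type} :
  inhabited X -> ~ le_card K X -> exists c, le_card X (elts (fun x => lt x c)).
Proof.
  intros HX H. destruct Hreg as [Hwo _].
  destruct (wo_compare lt Hwo HX) as [H' | (c & H' & _)]; [tauto | eauto].
Qed.

(* Well-order the pairs by maximum first: every initial segment then lies in a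
   square [below m * below m], which is small by regularity. *)
Lemma square_le_card : le_card (K * K) K.
Proof.
  pose (mx := fun p : K * K =>
    if excluded_middle_informative (lt (fst p) (snd p)) then snd p else fst p).
  assert (mx1 : forall p, leo lt (fst p) (mx p)).
  { intros p. unfold mx. destruct excluded_middle_informative; [left | right]; auto. }
  assert (mx2 : forall p, leo lt (snd p) (mx p)).
  { intros p. unfold mx. destruct excluded_middle_informative;
      [right; auto | apply not_lt; auto]. }
  pose (R := fun p q => lt (mx p) (mx q) \/ (mx p = mx q /\
    (lt (fst p) (fst q) \/ (fst p = fst q /\ lt (snd p) (snd q))))).
  assert (HR : is_wellorder R).
  { split; [|split; [|split]].
    - intros p. unfold R. pose proof (wo_irrefl (mx p)).
      pose proof (wo_irrefl (fst p)). pose proof (wo_irrefl (snd p)). tauto.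
    - intros p q r. unfold R.
      intros [H | (E & [H | (E' & H)])] [G | (F & [G | (F' & G)])];
        rewrite ?E, ?E', <- ?F, <- ?F'; eauto 6 using wo_trans.
    - intros [a b] [c d]. unfold R.
      destruct (wo_total (mx (a, b)) (mx (c, d))) as [H | [H | H]]; auto.
      rewrite H. simpl.
      destruct (wo_total a c) as [G | [-> | G]]; auto 6.
      destruct (wo_total b d) as [G | [-> | G]]; auto 7.
    (* Nested induction on the maximum, the first and the second coordinate. *)
    - assert (Hacc : forall m a b p, mx p = m -> fst p = a -> snd p = b -> Acc R p).
      { intros m. induction (wo_wf m) as [m _ IHm].
        intros a. induction (wo_wf a) as [a _ IHa].
        intros b. induction (wo_wf b) as [b _ IHb].
        intros p <- <- <-. constructor.
        intros q [H | (E & [H | (E' & H)])]; eauto. }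
      intros p; eauto. }
  destruct (wo_compare R HR card_inhabited) as [H | (c & H & _)]; [exact H|].
  exfalso. destruct (no_max (mx c)) as [m Hm].
  apply (small_union
    (fun (x : elts (fun x => lt x m)) (p : K * K) =>
       fst p = proj1_sig x /\ lt (snd p) m)).
  - apply not_le_card_seg.
  - intros [x Hx] H'. apply (not_le_card_seg m), (le_card_trans H').
    apply (le_card_rel (fun p y => snd (proj1_sig p) = proj1_sig y)).
    + intros [[y z] [E G]]; simpl in *. exists (exist _ z G); reflexivity.
    + intros [[y z] [E G]] [[y' z'] [E' G']] [w Hw]; simpl.
      intros <- ->. apply elts_eq; simpl in *; congruence.
  - apply (le_card_trans H), le_card_sub. intros p Hp.
    assert (Hpc : leo lt (mx p) (mx c)) by (unfold leo; destruct Hp as [? | [? _]]; auto).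
    pose proof (leo_lt_trans (leo_trans (mx1 p) Hpc) Hm) as H1.
    pose proof (leo_lt_trans (leo_trans (mx2 p) Hpc) Hm) as H2.
    exists (exist _ (fst p) H1); auto.
Qed.

Lemma exists_lub (A : K -> Prop) b :
  ub lt A b -> exists d, ub lt A d /\ forall e, lt e d -> exists x, A x /\ lt e x.
Proof.
  intros Hb. destruct (wf_min lt (ub lt A) wo_wf (ex_intro _ b Hb)) as (d & Hd & Hmin).
  exists d; split; [exact Hd|]. intros e He. apply NNPP. intros Hn.
  apply (Hmin e He). intros x Hx. apply not_lt. intros H. apply Hn; eauto.
Qed.

End Regular.

Lemma leo_max {K : Type} {lt : K -> K -> Prop} (Hreg : infinite_regular_cardinal lt)
    a b : exists c, leo lt a c /\ leo lt b c.
Proof.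
  destruct (classic (lt a b)) as [H | H].
  - exists b; split; [left; exact H | apply leo_refl].
  - exists a; split; [apply leo_refl | exact (not_lt lt Hreg H)].
Qed.

(** * Indecomposable ultrafilters and functions unbounded modulo [U] *)

Section Ultrafilter.

Context {Th : Type} (ltT : Th -> Th -> Prop) {K : Type} (lt : K -> K -> Prop)
  (HT : infinite_regular_cardinal ltT) (HK : infinite_regular_cardinal lt)
  (Hpow : lt_card (Th -> Prop) K)
  (U : (K -> Prop) -> Prop) (HU : uniform_ultrafilter U)
  (Hind : forall M : Type, le_card Th M -> lt_card M K -> indecomposable U M).

Lemma U_mono {A B : K -> Prop} : U A -> (forall x, A x -> B x) -> U B.
Proof. destruct HU as (_ & _ & H & _); eauto. Qed.

Lemma U_mono2 {A B C : K -> Prop} :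
  U A -> U B -> (forall x, A x -> B x -> C x) -> U C.
Proof.
  intros HA HB H. destruct HU as (_ & _ & _ & Hcap & _).
  apply (U_mono (Hcap A B HA HB)). intros x [? ?]; auto.
Qed.

Lemma U_inh {A : K -> Prop} : U A -> exists x, A x.
Proof.
  intros HA. apply NNPP. intros Hn. destruct HU as (_ & H & _). apply H.
  apply (U_mono HA). intros x Hx; apply Hn; eauto.
Qed.

Lemma U_not {A : K -> Prop} : ~ U A -> U (fun x => ~ A x).
Proof. destruct HU as (_ & _ & _ & _ & H & _). destruct (H A); tauto. Qed.

Lemma U_all {A : K -> Prop} : (forall x, A x) -> U A.
Proof. intros H. destruct HU as [HT' _]. apply (U_mono HT'); auto. Qed.

Lemma not_le_card_Th : ~ le_card K Th.
Proof.
  intros H. destruct Hpow as [_ Hn]. apply Hn, (le_card_trans H).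
  exists (fun i j => i = j). intros i j E.
  rewrite (f_equal (fun A => A j) E); reflexivity.
Qed.

Lemma not_le_card_segT i : ~ le_card K (elts (fun j => ltT j i)).
Proof. intros H. apply not_le_card_Th, (le_card_trans H), le_card_elts. Qed.

(** Otherwise send almost every [x] to a stage from which on it lies in no [B j]. Indecomposability
    and regularity of [Th] bound these stages by one [i] on a set in [U], against [B i] being in
    [U]. *)
Lemma theta_often (B : Th -> K -> Prop) :
  (forall i, U (B i)) -> U (fun x => forall i, exists j, leo ltT i j /\ B j x).
Proof.
  intros HB. apply NNPP. intros Hn. apply U_not in Hn.
  assert (Hs : forall x, exists i, ~ (forall i, exists j, leo ltT i j /\ B j x) ->
    forall j, leo ltT i j -> ~ B j x).
  { intros x. destruct (classic (exists i, forall j, leo ltT i j -> ~ B j x))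
      as [[i Hi] | H].
    - exists i; auto.
    - destruct (card_inhabited ltT HT) as [i]. exists i. intros H'. exfalso.
      apply H'. intros i'. apply NNPP. intros H''. apply H. exists i'.
      intros j Hj HBj. apply H''; eauto. }
  pose (s := fun x => proj1_sig (constructive_indefinite_description _ (Hs x))).
  destruct (Hind Th (le_card_refl Th) (not_le_card_lt lt HK _ not_le_card_Th) s)
    as (H & [_ Hlt] & HUH).
  destruct (small_bounded ltT HT H Hlt) as [i Hi].
  assert (Hbad : U (fun x => ~ B i x)).
  { apply (U_mono2 Hn HUH). intros y Hy HHy.
    apply (proj2_sig (constructive_indefinite_description _ (Hs y)) Hy).
    left; apply Hi, HHy. }
  destruct (U_inh (U_mono2 (HB i) Hbad (fun x h1 h2 => h2 h1))) as [_ []].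
Qed.

Definition unbounded (g : K -> K) : Prop := forall a, U (fun x => lt a (g x)).

Lemma not_unbounded {g} : ~ unbounded g -> exists a, U (fun x => leo lt (g x) a).
Proof.
  intros H. apply not_all_ex_not in H. destruct H as [a Ha]. exists a.
  apply (U_mono (U_not Ha)). intros x Hx; apply (not_lt lt HK); exact Hx.
Qed.

Lemma unbounded_id : unbounded (fun x => x).
Proof.
  apply NNPP. intros H. destruct (not_unbounded H) as [a Ha].
  destruct (no_max lt HK a) as [b Hb]. destruct HU as (_ & _ & _ & _ & _ & Hcard).
  apply (not_le_card_seg lt HK b), (le_card_trans (eq_card_le (Hcard _ Ha))).
  apply le_card_sub. intros x Hx. exact (leo_lt_trans lt HK Hx Hb).
Qed.

(** The interval is half-open, so that successive intervals are disjoint. *)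
Definition meets (E : K -> K -> Prop) (a b : K) (x : K) : Prop :=
  exists e, E x e /\ leo lt a e /\ lt e b.

(** Iterate the hypothesis along [Th], starting each interval at or past the ends of all earlier
    ones, and apply [theta_often] to the result. *)
Lemma meets_chain (E : K -> K -> Prop) a :
  (forall b, exists c, U (meets E b c)) ->
  exists p q : Th -> K,
    (forall i, leo lt a (p i)) /\ (forall i, lt (p i) (q i)) /\
    (forall i j, ltT i j -> leo lt (q i) (p j)) /\
    U (fun x => forall i, exists j, leo ltT i j /\ meets E (p j) (q j) x).
Proof.
  intros H.
  pose (n := fun b => proj1_sig (constructive_indefinite_description _ (H b))).
  assert (Hn : forall b, U (meets E b (n b))).
  { intros b. exact (proj2_sig (constructive_indefinite_description _ (H b))). }
  destruct (wf_choice ltT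
    (fun i (f : Th -> K) v => leo lt a v /\ forall j, ltT j i -> leo lt (n (f j)) v)
    (wo_wf ltT HT) (card_inhabited lt HK)) as [p Hp].
  - intros i f f' v Ef [Ha Hv]; split; [exact Ha|].
    intros j Hj; rewrite <- Ef by exact Hj; auto.
  - intros i f _.
    destruct (small_family_bounded lt HK
      (fun j : elts (fun j => ltT j i) => n (f (proj1_sig j)))
      (not_le_card_segT i)) as [c Hc].
    destruct (leo_max HK a c) as (d & Had & Hcd). exists d; split; [exact Had|].
    intros j Hj. left. exact (lt_leo_trans lt HK (Hc (exist _ j Hj)) Hcd).
  - exists p, (fun i => n (p i)). split; [apply Hp|]. split; [|split].
    + intros i. destruct (U_inh (Hn (p i))) as (x & e & _ & Hpe & Hen).
      exact (leo_lt_trans lt HK Hpe Hen).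
    + intros i j Hij. apply Hp, Hij.
    + apply theta_often. auto.
Qed.

(** The intervals of [meets_chain] are pairwise disjoint, so an [E x] that meets theta many of them
    has at least theta members. *)
Lemma small_not_meets (E : K -> K -> Prop) (X : Type) :
  ~ le_card Th X -> (forall x, le_card (elts (E x)) X) ->
  ~ (forall b, exists c, U (meets E b c)).
Proof.
  intros HX HE H. destruct (card_inhabited lt HK) as [a].
  destruct (meets_chain E a H) as (p & q & _ & _ & Hpq & Hx).
  destruct (U_inh Hx) as [x Hx'].
  apply HX. refine (le_card_trans _ (HE x)).
  refine (le_card_trans (unbounded_le_card ltT HT (fun j => meets E (p j) (q j) x) _) _).
  - intros i. destruct (Hx' i) as (j & ? & ?); eauto.
  - assert (Hdis : forall i j e, ltT i j -> lt e (q i) -> ~ leo lt (p j) e).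
    { intros i j e Hij He Hpe. apply (wo_irrefl lt HK e).
      exact (lt_leo_trans lt HK He (leo_trans lt HK (Hpq i j Hij) Hpe)). }
    apply (le_card_rel (fun j e => leo lt (p (proj1_sig j)) (proj1_sig e) /\
                                   lt (proj1_sig e) (q (proj1_sig j)))).
    + intros [j (e & He & ? & ?)]. exists (exist _ e He); auto.
    + intros [i Hi] [j Hj] [e He]; simpl; intros [H1 H2] [H3 H4].
      apply elts_eq; simpl.
      destruct (wo_total ltT HT i j) as [Hij | [Hij | Hij]]; [|exact Hij|].
      * destruct (Hdis _ _ _ Hij H2 H3).
      * destruct (Hdis _ _ _ Hij H4 H1).
Qed.

(* Otherwise choose unbounded [f_i], for [i] in [Th], with [f_i] below every value
   [f_j], [j < i], that exceeds some bound [b_i]; such an [f_i] exists because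
   fewer than theta values cannot be cofinal below the unbounded functions
   ([small_not_meets]).  Past [sup b_i], a point lying in theta many of the
   comparison sets gives an infinite decreasing sequence [f_i x]. *)
Lemma least_unbounded :
  exists g, unbounded g /\
    forall h, U (fun x => lt (h x) (g x)) -> exists a, U (fun x => leo lt (h x) a).
Proof.
  apply NNPP. intros Hno.
  assert (Hdown : forall g, unbounded g ->
    exists h, U (fun x => lt (h x) (g x)) /\ unbounded h).
  { intros g Hg. apply NNPP. intros Hn. apply Hno. exists g; split; [exact Hg|].
    intros h Hh. apply not_unbounded. intros Hu; apply Hn; eauto. }
  destruct (wf_choice ltT
    (fun i (f : Th -> K -> K) v => unbounded v /\ exists b, U (fun x =>
       forall j, ltT j i -> leo lt b (f j x) -> lt (v x) (f j x)))
    (wo_wf ltT HT) (inhabits (fun x => x))) as [f Hf].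
  - intros i f f' v Ef [Hv [b Hb]]; split; [exact Hv|]. exists b.
    apply (U_mono Hb). intros x Hx j Hj. rewrite <- Ef by exact Hj. auto.
  - intros i f _. apply NNPP. intros Hn.
    (* The sets tested are the values at [x] of the functions chosen before stage [i]. *)
    apply (small_not_meets (fun x e => exists j, ltT j i /\ f j x = e)
             (elts (fun j => ltT j i))).
    + apply (not_le_card_seg ltT HT).
    + intros x. exact (le_card_image (fun j => ltT j i) (fun j => f j x)).
    + intros b.
      destruct (classic (U (fun x => exists j, ltT j i /\ leo lt b (f j x))))
        as [Hb | Hb].
      (* [q x] is the least earlier value at or above [b], so a function below [q] is below all such
         values. *)
      * assert (Hq : forall x, exists e,
          (exists j, ltT j i /\ leo lt b (f j x)) ->
          ((exists j, ltT j i /\ f j x = e) /\ leo lt b e) /\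
          forall j, ltT j i -> leo lt b (f j x) -> leo lt e (f j x)).
        { intros x.
          destruct (classic (exists j, ltT j i /\ leo lt b (f j x)))
            as [(j & Hj & Hbj) | Hx].
          - destruct (wf_min lt
              (fun e => (exists j, ltT j i /\ f j x = e) /\ leo lt b e)
              (wo_wf lt HK)) as (e & He & Hmin).
            { exists (f j x); eauto. }
            exists e. intros _. split; [exact He|]. intros j' Hj' Hbj'.
            apply (not_lt lt HK). intros Hlt. apply (Hmin _ Hlt); eauto.
          - exists x; tauto. }
        pose (q := fun x => proj1_sig (constructive_indefinite_description _ (Hq x))).
        assert (Hq' := fun x =>
          proj2_sig (constructive_indefinite_description _ (Hq x))).
        destruct (classic (unbounded q)) as [Hu | Hu].
        -- destruct (Hdown q Hu) as (h & Hh & Huh). exfalso. apply Hn.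
           exists h; split; [exact Huh|]. exists b. apply (U_mono Hh).
           intros x Hx j Hj Hbj. apply (lt_leo_trans lt HK Hx).
           apply Hq'; eauto.
        -- destruct (not_unbounded Hu) as [a Ha].
           destruct (no_max lt HK a) as [c Hc]. exists c.
           apply (U_mono2 Hb Ha). intros x Hx Hqx. exists (q x).
           destruct (Hq' x Hx) as [[H1 H2] _]. split; [exact H1|].
           split; [exact H2|]. exact (leo_lt_trans lt HK Hqx Hc).
      (* Almost no point has an earlier value at or above [b], so the identity meets the comparison
         vacuously. *)
      * exfalso. apply Hn. exists (fun x => x); split; [exact unbounded_id|].
        exists b. apply (U_mono (U_not Hb)). intros x Hx j Hj Hbj.
        destruct Hx; eauto.
  - pose (b := fun i => proj1_sig (constructive_indefinite_description _ (proj2 (Hf i)))).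
    assert (Hb := fun i =>
      proj2_sig (constructive_indefinite_description _ (proj2 (Hf i)))).
    destruct (small_family_bounded lt HK b not_le_card_Th) as [c Hc].
    destruct (U_inh (theta_often (fun i x => lt c (f i x) /\
      forall j, ltT j i -> leo lt (b i) (f j x) -> lt (f i x) (f j x))
      (fun i => U_mono2 (proj1 (Hf i) c) (Hb i) (fun x h1 h2 => conj h1 h2))))
      as [x Hx].
    destruct (wf_min lt (fun e => exists i, lt c (f i x) /\ f i x = e)
      (wo_wf lt HK)) as (e & (i & Hi & <-) & Hmin).
    { destruct (card_inhabited ltT HT) as [i]. destruct (Hx i) as (j & _ & Hj & _).
      eauto. }
    destruct (no_max ltT HT i) as [i' Hi']. destruct (Hx i') as (j & Hj & Hcj & Hdec).
    apply (Hmin (f j x)); [|eauto].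
    apply Hdec; [exact (lt_leo_trans ltT HT Hi' Hj)|].
    left. exact (wo_trans lt HK (Hc j) Hi).
Qed.

(** Among the sets that contain almost all values of [f], take one of least size, measured by
    initial segments of [K]. If it had at least theta elements, indecomposability at its own size
    would shrink it. *)
Lemma small_image {V : Type} (f : K -> V) (S : V -> Prop) :
  U (fun x => S (f x)) -> ~ le_card K (elts S) ->
  exists H : V -> Prop, U (fun x => H (f x)) /\ ~ le_card Th (elts H).
Proof.
  intros HS Hsmall.
  assert (Hinh : forall S : V -> Prop, U (fun x => S (f x)) -> inhabited (elts S)).
  { intros S' HS'. destruct (U_inh HS') as [x Hx]. exact (inhabits (exist _ _ Hx)). }
  destruct (wf_min lt (fun c => exists S : V -> Prop,
      U (fun x => S (f x)) /\ le_card (elts S) (elts (fun x => lt x c)))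
    (wo_wf lt HK)) as (c & (H & HUH & Hle) & Hmin).
  { destruct (small_seg lt HK (Hinh S HS) Hsmall) as [c Hc]; eauto. }
  exists H; split; [exact HUH|]. intros HTh.
  assert (HlK : ~ le_card K (elts H)).
  { intros H'. exact (not_le_card_seg lt HK c (le_card_trans H' Hle)). }
  destruct (Hinh H HUH) as [d].
  (* The default [d] is taken only off a set in [U]. *)
  pose (f' := fun x => match excluded_middle_informative (H (f x)) with
    | left h => exist H (f x) h | right _ => d end).
  destruct (Hind (elts H) HTh (not_le_card_lt lt HK _ HlK) f') as (G & HGlt & HG).
  pose (S' := fun v => exists p : elts H, G p /\ proj1_sig p = v).
  assert (HS' : U (fun x => S' (f x))).
  { apply (U_mono2 HUH HG). intros x Hx HGx. unfold f' in HGx.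
    destruct (excluded_middle_informative (H (f x))) as [h | h]; [|tauto].
    exists (exist _ _ h); auto. }
  pose proof (le_card_image G (@proj1_sig _ H) : le_card (elts S') (elts G)) as HS'G.
  (* A size [e] of [S'] below [c] contradicts minimality; any other size would make [G] as large as
     [H]. *)
  destruct (wo_compare lt (proj1 HK) (Hinh S' HS')) as [HKS | (e & He & He')].
  - apply HlK, (le_card_trans HKS), (le_card_trans HS'G), HGlt.
  - destruct (classic (lt e c)) as [Hec | Hec]; [apply (Hmin e Hec); eauto|].
    apply (proj2 HGlt), (le_card_trans Hle), (fun h => le_card_trans h HS'G).
    refine (le_card_trans _ He'). apply le_card_sub. intros x Hx.
    exact (lt_leo_trans lt HK Hx (not_lt lt HK Hec)).
Qed.

End Ultrafilter.

(** * Counting the traces of a square sequence *)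

Definition traces {K : Type} (lt : K -> K -> Prop) (F : K -> (K -> Prop) -> Prop)
    (a : K) (s : K -> Prop) : Prop :=
  exists b C, F b C /\ s = cap C (below lt a).

(* If [a] is not a limit point of [C], then the trace of [C] on [a] comes from its
   trace on some [c < a] by adding at most the point [c]; otherwise coherence
   puts it in [F a]. *)
Lemma traces_small {K : Type} (lt : K -> K -> Prop) (F : K -> (K -> Prop) -> Prop) a :
  infinite_regular_cardinal lt -> square_seq lt F ->
  ~ le_card K (elts (traces lt F a)).
Proof.
  intros HK (Fex & Fsmall & Fcl & Fcoh & _).
  induction (wo_wf lt HK a) as [a _ IH]. intros Hle.
  pose (T := fun c s => traces lt F c s \/
    exists t, traces lt F c t /\ (fun x => t x \/ x = c) = s).
  apply (small_cup lt HK (F a)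
    (fun s => exists c : elts (fun c => lt c a), T (proj1_sig c) s)).
  - apply Fsmall.
  - apply (small_union lt HK (fun c : elts (fun c => lt c a) => T (proj1_sig c))).
    + apply (not_le_card_seg lt HK).
    + intros [c Hc]. apply (small_cup lt HK); [exact (IH c Hc)|].
      intros H. apply (IH c Hc), (le_card_trans H), le_card_image.
  - apply (le_card_trans Hle), le_card_sub. intros s (b & C & HC & ->).
    assert (HCb : forall x, C x -> lt x b) by apply (Fcl b C HC).
    destruct (classic (exists c, lt c a /\ forall x, C x -> lt x a -> leo lt x c))
      as [(c & Hc & Hsup) | Hlim].
    + right. exists (exist _ c Hc). simpl.
      assert (Ht : traces lt F c (cap C (below lt c))) by (exists b, C; auto).
      destruct (classic (C c)) as [HCc | HCc].
      * right. exists (cap C (below lt c)). split; [exact Ht|].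
        extensionality x. apply propositional_extensionality. unfold cap, below.
        split.
        -- intros [[H1 H2] | ->]; [|auto]. split; [exact H1|].
           exact (wo_trans lt HK H2 Hc).
        -- intros [H1 H2]. destruct (Hsup x H1 H2) as [H | H]; auto.
      * left. replace (cap C (below lt a)) with (cap C (below lt c)); [exact Ht|].
        extensionality x. apply propositional_extensionality. unfold cap, below.
        split; intros [H1 H2]; split; auto.
        -- exact (wo_trans lt HK H2 Hc).
        -- destruct (Hsup x H1 H2) as [H | ->]; tauto.
    + left. assert (Hlim' : forall d, lt d a -> exists e, C e /\ lt d e /\ lt e a).
      { intros d Hd. apply NNPP. intros Hn. apply Hlim. exists d.
        split; [exact Hd|]. intros x Hx Hxa. apply (not_lt lt HK). intros Hdx.
        apply Hn; eauto. }
      assert (Hab : forall d, lt d a -> leo lt a b).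
      { intros d Hd. apply (not_lt lt HK). intros Hba.
        destruct (Hlim' b Hba) as (e & He & Hbe & _).
        exact (wo_irrefl lt HK b (wo_trans lt HK Hbe (HCb e He))). }
      destruct (classic (exists d, lt d a)) as [[d Hd] | H0].
      * destruct (Hab d Hd) as [Hlt | ->].
        -- apply (Fcoh b); [exact HC|].
           assert (Hlimpt : limpt lt C a) by (split; eauto).
           split; [|exact Hlimpt]. exact (proj2 (proj1 (Fcl b C HC)) a Hlt Hlimpt).
        -- replace (cap C (below lt b)) with C; [exact HC|].
           extensionality x. apply propositional_extensionality. unfold cap, below.
           split; [auto | tauto].
      (* Here [a] is the least element: every trace is empty, and so is [C0]. *)
      * destruct (Fex a) as [C0 HC0]. replace (cap C (below lt a)) with C0; [exact HC0|].
        extensionality x. apply propositional_extensionality. unfold cap, below.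
        split; [|intros [_ H]; exfalso; eauto].
        intros Hx. exfalso. apply H0. exists x. apply (Fcl a C0 HC0); exact Hx.
Qed.

(** * From few traces to a covering *)

Section Transversal.

Context {Th : Type} (ltT : Th -> Th -> Prop) {K : Type} (lt : K -> K -> Prop)
  (HT : infinite_regular_cardinal ltT) (HK : infinite_regular_cardinal lt)
  (Hpow : lt_card (Th -> Prop) K)
  (U : (K -> Prop) -> Prop) (HU : uniform_ultrafilter U)
  (Hind : forall M : Type, le_card Th M -> lt_card M K -> indecomposable U M)
  (g : K -> K) (Hg : unbounded lt U g)
  (Hleast : forall h : K -> K, U (fun x => lt (h x) (g x)) ->
     exists a, U (fun x => leo lt (h x) a)).

(** Leastness of [g] bounds the choice [h x] in [Cs (g x)], which supplies the intervals. Their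
    limit [d] is below [g x] for almost all [x], so closedness puts it in [Cs (g x)]. *)
Lemma often_member_unbounded (Cs : K -> K -> Prop) a :
  (forall b, closed_in lt b (Cs b) /\ same_sup lt (Cs b) (below lt b)) ->
  exists d, U (fun x => Cs (g x) d) /\ leo lt a d.
Proof.
  intros HCs.
  destruct (meets_chain ltT lt HT HK Hpow U HU Hind (fun x => Cs (g x)) a)
    as (p & q & Hap & Hpq & Hqp & Hmeet).
  { intros b. destruct (no_max lt HK b) as [b' Hb'].
    assert (Hh : forall x, exists e, lt b' (g x) -> Cs (g x) e /\ leo lt b e).
    { intros x. destruct (classic (exists e, Cs (g x) e /\ leo lt b e))
        as [[e He] | Hn]; [exists e; auto|].
      exists x. intros Hbx. exfalso.
      assert (Hub : ub lt (Cs (g x)) b).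
      { intros e He. left. apply (not_leo lt HK). intros Hbe. apply Hn; eauto. }
      apply (proj2 (HCs (g x)) b) in Hub.
      exact (leo_not_lt lt HK (Hub b' Hbx) Hb'). }
    pose (h := fun x => proj1_sig (constructive_indefinite_description _ (Hh x))).
    assert (Hh' := fun x =>
      proj2_sig (constructive_indefinite_description _ (Hh x))).
    destruct (Hleast h) as [c Hc].
    { apply (U_mono U HU (Hg b')). intros x Hx.
      apply (proj1 (HCs (g x))), Hh', Hx. }
    destruct (no_max lt HK c) as [c' Hc']. exists c'.
    apply (U_mono2 U HU (Hg b') Hc). intros x Hx Hhx. exists (h x).
    destruct (Hh' x Hx) as [H1 H2]. split; [exact H1|]. split; [exact H2|].
    exact (leo_lt_trans lt HK Hhx Hc'). }
  destruct (small_family_bounded lt HK p (not_le_card_Th Hpow)) as [c Hc].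
  destruct (exists_lub lt HK (fun x => exists i, p i = x) c) as (d & Hub & Hlub).
  { intros x [i <-]; left; apply Hc. }
  destruct (card_inhabited ltT HT) as [i0].
  assert (Hpd : leo lt (p i0) d) by (apply Hub; eauto).
  exists d. split; [|exact (leo_trans lt HK (Hap i0) Hpd)].
  apply (U_mono2 U HU (Hg d) Hmeet). intros x Hdx Hx.
  apply (proj1 (HCs (g x))); [exact Hdx|].
  assert (Hfind : forall i, exists e, Cs (g x) e /\ leo lt (p i) e /\ lt e d).
  { intros i. destruct (Hx i) as (j & Hij & e & He & Hpe & Heq).
    (* The later stage [k] gives that [q j] is at most [p k], hence at most [d]; so [e] is strictly
       below [d]. *)
    destruct (no_max ltT HT j) as [k Hk]. exists e. split; [exact He|]. split.
    - destruct Hij as [Hij | ->]; [|exact Hpe].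
      left. exact (lt_leo_trans lt HK (lt_leo_trans lt HK (Hpq i) (Hqp i j Hij)) Hpe).
    - apply (lt_leo_trans lt HK Heq), (leo_trans lt HK (Hqp j k Hk)), Hub. eauto. }
  split.
  - destruct (Hfind i0) as (e & _ & _ & He); eauto.
  - intros b Hb. destruct (Hlub b Hb) as (_ & [i <-] & Hi).
    destruct (Hfind i) as (e & He & Hpe & Hed). exists e.
    split; [exact He|]. split; [exact (lt_leo_trans lt HK Hi Hpe) | exact Hed].
Qed.

Definition few_traces (Cs : K -> K -> Prop) (a : K) (X : Type) : Prop :=
  exists H : (K -> Prop) -> Prop, le_card (elts H) X /\
    U (fun x => H (cap (Cs (g x)) (below lt a))).

(** For [d] below [a] that lies in almost all [Cs (g x)], some such [x] has its trace in [H]; the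
    representative chosen for that trace then contains [d] as well. *)
Lemma few_traces_chi_witness (Cs : K -> K -> Prop) (X : Type) :
  (forall b, closed_in lt b (Cs b) /\ same_sup lt (Cs b) (below lt b)) ->
  le_card X Th -> (forall a, few_traces Cs a X) -> chi_witness lt Cs X.
Proof.
  intros HCs HX Hfew.
  assert (HKX : ~ le_card K X).
  { intros H. exact (not_le_card_Th Hpow (le_card_trans H HX)). }
  exists (fun d => U (fun x => Cs (g x) d)). split.
  { apply HK. intros a. exact (often_member_unbounded Cs a HCs). }
  assert (Hb : forall a, exists B : K -> Prop, eq_card (elts B) X /\
    forall d, U (fun x => Cs (g x) d) -> lt d a -> exists b, B b /\ Cs b d).
  { intros a. destruct (Hfew a) as (H & HHX & HUH).
    pose (r := fun s => epsilon (card_inhabited lt HK)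
      (fun x => cap (Cs (g x)) (below lt a) = s)).
    pose proof (le_card_trans (le_card_image H (fun s => g (r s))) HHX) as HAX.
    destruct (pad_card _ HAX) as (B & HAB & HBX).
    (* The chosen indices are bounded, so their complement has size [K] and leaves room for the
       padding. *)
    - destruct (small_bounded lt HK (fun y => exists s, H s /\ g (r s) = y))
        as [c Hc].
      { intros H'. exact (HKX (le_card_trans H' HAX)). }
      refine (le_card_trans (proj1 (not_le_card_lt lt HK _ HKX)) _).
      apply (unbounded_le_card lt HK). intros e.
      destruct (leo_max HK e c) as (d & Hed & Hcd). exists d.
      split; [|exact Hed]. intros Hd.
      exact (leo_not_lt lt HK Hcd (Hc d Hd)).
    - exists B; split; [exact HBX|]. intros d Hd Hda.
      destruct (U_inh U HU (U_mono2 U HU Hd HUH (fun x h1 h2 => conj h1 h2)))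
        as (x & Hxd & HHx).
      exists (g (r (cap (Cs (g x)) (below lt a)))). split; [apply HAB; eauto|].
      assert (E : cap (Cs (g (r (cap (Cs (g x)) (below lt a))))) (below lt a) =
                  cap (Cs (g x)) (below lt a)).
      { unfold r. apply epsilon_spec. eauto. }
      assert (Hin : cap (Cs (g x)) (below lt a) d) by (split; assumption).
      rewrite <- E in Hin. apply Hin. }
  exists (fun a => proj1_sig (constructive_indefinite_description _ (Hb a))).
  split; intros a;
    destruct (proj2_sig (constructive_indefinite_description _ (Hb a))); auto.
Qed.

End Transversal.

(* Unlike [le_card], this gives a code defined on all of [T]. *)
Lemma le_card_fun {T Z : Type} (A : T -> Prop) :
  inhabited Z -> le_card (elts A) Z ->
  exists e : T -> Z, forall x y, A x -> A y -> e x = e y -> x = y.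
Proof.
  intros [z] [e He].
  exists (fun x => match excluded_middle_informative (A x) with
    | left h => e (exist A x h) | right _ => z end).
  intros x y Hx Hy.
  destruct (excluded_middle_informative (A x)); [|tauto].
  destruct (excluded_middle_informative (A y)); [|tauto].
  intros E. exact (f_equal (@proj1_sig _ _) (He _ _ E)).
Qed.

(** * One bound for all transversals, by joint coding of traces *)

Theorem theorem4p5
  (Th : Type) (ltT : Th -> Th -> Prop)
  (K : Type) (lt : K -> K -> Prop) :
  infinite_regular_cardinal ltT ->
  infinite_regular_cardinal lt ->
  lt_card (Th -> Prop) K ->
  (exists U : (K -> Prop) -> Prop,
     uniform_ultrafilter U /\
     forall M : Type, le_card Th M -> lt_card M K -> indecomposable U M) ->
  exists M : Type, lt_card M Th /\
    forall Cs : K -> K -> Prop, transversal lt Cs ->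
      exists X : Type, le_card X M /\ le_card X K /\ chi_witness lt Cs X.
Proof.
  intros HT HK Hpow (U & HU & Hind).
  destruct (least_unbounded ltT lt HT HK Hpow U HU Hind) as (g & Hg & Hleast).
  apply NNPP. intros Hn.
  assert (Hbad : forall i, exists Cs, transversal lt Cs /\
    exists a, ~ few_traces lt U g Cs a (elts (fun j => ltT j i))).
  { intros i. apply NNPP. intros Hi. apply Hn.
    exists (elts (fun j => ltT j i)). split; [apply HT|].
    intros Cs HCs. exists (elts (fun j => ltT j i)).
    assert (HiT : le_card (elts (fun j => ltT j i)) Th) by apply le_card_elts.
    split; [apply le_card_refl|]. split.
    - apply (le_card_trans HiT), (not_le_card_lt lt HK), (not_le_card_Th Hpow).
    - apply (few_traces_chi_witness ltT lt HT HK Hpow U HU Hind g Hg Hleast);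
        [|exact HiT|].
      + destruct HCs as (F & (_ & _ & Hcl & _) & HF). auto.
      + intros a. apply NNPP. intros Ha. apply Hi; eauto. }
  destruct (choice _ Hbad) as [Cs HCs].
  destruct (choice (fun i a => ~ few_traces lt U g (Cs i) a (elts (fun j => ltT j i)))
    (fun i => proj2 (HCs i))) as [a Ha].
  pose (f := fun i x => cap (Cs i (g x)) (below lt (a i))).
  assert (Hsmall : forall i, exists H : (K -> Prop) -> Prop,
    U (fun x => H (f i x)) /\ ~ le_card Th (elts H)).
  { intros i. destruct (proj1 (HCs i)) as (F & HF & HFC).
    apply (small_image lt HK U HU Hind (f i) (traces lt F (a i))).
    - apply (U_all U HU). intros x. exists (g x), (Cs i (g x)); auto.
    - exact (traces_small lt F (a i) HK HF). }
  destruct (choice _ Hsmall) as [H HH].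
  assert (Hcode : forall i, exists e : (K -> Prop) -> Th,
    forall s t, H i s -> H i t -> e s = e t -> s = t).
  { intros i. apply le_card_fun; [exact (card_inhabited ltT HT)|].
    apply (not_le_card_lt ltT HT), HH. }
  destruct (choice _ Hcode) as [e He].
  destruct (square_le_card ltT HT) as [pair_code Hpair].
  (* [code x] is a subset of [Th] that records all traces of [x] at once; [i] is skipped when the
     trace is outside [H i], where [e i] need not be injective. *)
  pose (code := fun x u => exists i, H i (f i x) /\ u = pair_code (i, e i (f i x))).
  destruct (small_image lt HK U HU Hind code (fun _ => True)) as (G & HUG & HG).
  { apply (U_all U HU); auto. }
  { intros H'. apply (proj2 Hpow), (le_card_trans H'), le_card_elts. }
  (* Fewer than theta codes embed in one initial segment of [Th]; its endpoint [i] is the index to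
     be refuted. *)
  destruct (small_seg ltT HT (X := elts G)) as [i Hi]; [|exact HG|].
  { destruct (U_inh U HU HUG) as [x Hx]. exact (inhabits (exist _ _ Hx)). }
  apply (Ha i). exists (fun s => exists x, G (code x) /\ H i (f i x) /\ f i x = s).
  split.
  - refine (le_card_trans _ Hi).
    (* A code determines the [i]-th trace, since [pair_code] keeps the index. *)
    apply (le_card_rel (fun s c => exists x, proj1_sig c = code x /\
      H i (f i x) /\ f i x = proj1_sig s)).
    + intros [s (x & HGx & HHx & Es)]. exists (exist _ _ HGx). exists x; auto.
    + intros s s' c (x & Ex & HHx & Es) (y & Ey & HHy & Es').
      apply elts_eq. rewrite <- Es, <- Es'. apply (He i); [assumption..|].
      assert (Hx : code x (pair_code (i, e i (f i x)))) by (exists i; auto).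
      rewrite <- Ex, Ey in Hx. destruct Hx as (i' & _ & E).
      apply Hpair in E. injection E as <- E. exact E.
  - apply (U_mono2 U HU HUG (proj1 (HH i))). intros x HGx HHx. exists x; auto.
Qed.
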